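(* Let $\mathcal{P}_4$ be the set of partitions $\lambda=(\lambda_1>\cdots>\lambda_\ell)$ into distinct positive parts such that for each $1\le i<\ell$: $\lambda_i-\lambda_{i+1}\equiv2\pmod 4$ if both are odd; $\equiv0\pmod 4$ if both are even; $\equiv3\pmod 4$ if they have different parity; and the smallest part $\lambda_\ell\equiv1$ or $2\pmod 4$. Let $\mathcal{S}_4$ be the set of partitions into distinct positive parts none of which is divisible by $4$. For $n\ge0$, let $\mathcal{P}_{4,e}(n)$, $\mathcal{P}_{4,o}(n)$ be the numbers of partitions of $n$ in $\mathcal{P}_4$ with an even, respectively odd, number of parts, and $\mathcal{S}_{4,e}(n)$, $\mathcal{S}_{4,o}(n)$ the analogous numbers for $\mathcal{S}_4$. Then for every $n\ge0$, $$\mathcal{P}_{4,e}(n)-\mathcal{P}_{4,o}(n)=\mathcal{S}_{4,e}(n)-\mathcal{S}_{4,o}(n).$$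
   Context: A partition of $n$ is a partition whose parts sum to $n$; the empty partition is the unique partition of $0$. *)

(* Defs.v *)
From mathcomp Require Import all_boot all_order all_algebra.

Set Implicit Arguments.
Unset Strict Implicit.
Unset Printing Implicit Defensive.

Definition is_partition (n : nat) (s : seq nat) : bool :=
  [&& sorted geq s, all (leq 1) s & sumn s == n].

Definition distinct_parts (s : seq nat) : bool := sorted gtn s.

(* Gap condition between consecutive parts a > b; the truncated subtraction
   is exact because [inP4] also requires the parts to be decreasing. *)
Definition P4_gap (a b : nat) : bool :=
  if odd a then
    if odd b then a - b == 2 %[mod 4] else a - b == 3 %[mod 4]
  else
    if odd b then a - b == 3 %[mod 4] else a - b == 0 %[mod 4].

(* The condition on the smallest part is vacuous for the empty partition,
   so [::] belongs to P4. *)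
Definition inP4 (s : seq nat) : bool :=
  [&& distinct_parts s, sorted P4_gap s &
      (s == [::]) || (last 0 s == 1 %[mod 4]) || (last 0 s == 2 %[mod 4])].

Definition inS4 (s : seq nat) : bool :=
  distinct_parts s && all (fun k => ~~ (4 %| k)) s.

(* A partition of n has at most n parts, each at most n, so all partitions of
   n occur (once each) in the finite type n.-bseq 'I_n.+1; see
   [is_partition_bseq]. *)
Definition parts (n : nat) (t : n.-bseq 'I_n.+1) : seq nat := map val t.

Definition count_partitions (Q : pred (seq nat)) (n : nat) : nat :=
  #|[set t : n.-bseq 'I_n.+1 | is_partition n (parts t) && Q (parts t)]|.

Definition P4e (n : nat) : nat :=
  count_partitions (fun s => inP4 s && ~~ odd (size s)) n.
Definition P4o (n : nat) : nat :=
  count_partitions (fun s => inP4 s && odd (size s)) n.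
Definition S4e (n : nat) : nat :=
  count_partitions (fun s => inS4 s && ~~ odd (size s)) n.
Definition S4o (n : nat) : nat :=
  count_partitions (fun s => inS4 s && odd (size s)) n.

Lemma parts_inj (n : nat) : injective (@parts n).
Proof. by move=> t u /(inj_map val_inj) /val_inj. Qed.

Lemma is_partition_bseq (n : nat) (s : seq nat) :
  is_partition n s -> exists t : n.-bseq 'I_n.+1, parts t = s.
Proof.
case/and3P=> _ s_gt0 /eqP s_sum.
have s_size : size s <= n.
  rewrite -s_sum; elim: s s_gt0 {s_sum} => //= k s IHs /andP[k_gt0 /IHs].
  by rewrite -add1n; apply: leq_add.
have s_le k : k \in s -> k < n.+1.
  rewrite ltnS -s_sum; elim: s {s_gt0 s_sum s_size} => //= j s IHs.
  rewrite inE => /predU1P[-> | /IHs]; first exact: leq_addr.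
  by move/leq_trans; apply; apply: leq_addl.
have t_size : size (map (@inord n) s) <= n by rewrite size_map.
exists (Bseq t_size); rewrite /parts /= -map_comp -[RHS]map_id.
by apply/eq_in_map => k /s_le k_le /=; rewrite inordK.
Qed.

(* Main.v *)
Require Import Defs.
From mathcomp Require Import all_boot all_order all_algebra.
From mathcomp Require Import zify ring.

(* Each signed generating function is computed in an arbitrary commutative ring
   with an element x such that x^(n+1) = 0, and is finally read off in
   Z[X]/(X^(n+1)).  Deleting or lowering the smallest part shows that P_4
   partitions with N parts have generating function
   q^(N^2) (-q;q^2)_N / (q^4;q^4)_N.  Their alternating sum over N is
   (q;q^2)_oo / (-q^2;q^2)_oo, a case of the q-Gauss (1phi1) summation, and this
   equals (q;q)_oo / (q^4;q^4)_oo, which is the product over the integers k not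
   divisible by 4 of 1 - q^k. *)

Set Implicit Arguments.
Unset Strict Implicit.
Unset Printing Implicit Defensive.

Import GRing.Theory.

(** * Enumeration of the partitions of 0, ..., n *)

Definition partitions_upto (n : nat) : seq (seq nat) :=
  undup (flatten [seq [seq parts t | t <- enum {: m.-bseq 'I_m.+1}
                                   & is_partition m (parts t)]
                 | m <- iota 0 n.+1]).

Lemma mem_partitions_upto n s :
  (s \in partitions_upto n) = is_partition (sumn s) s && (sumn s <= n).
Proof.
rewrite mem_undup; apply/flatten_mapP/andP => [[m]|[s_part s_le]].
  rewrite mem_iota => /andP[_ m_lt] /mapP[t]; rewrite mem_filter.
  case/andP=> t_part _ ->; case/and3P: (t_part) => _ _ /eqP t_sum.
  by rewrite t_sum.
exists (sumn s); first by rewrite mem_iota.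
have [t Et] := is_partition_bseq s_part.
by apply/mapP; exists t; rewrite // mem_filter Et s_part mem_enum.
Qed.

Lemma count_partitionsE Q n :
  count_partitions Q n = count (fun s => Q s && (sumn s == n))
                                   (partitions_upto n).
Proof.
rewrite /count_partitions cardE -(size_map (@parts n)) -size_filter.
apply/perm_size/uniq_perm => [||s].
- by rewrite (map_inj_uniq (@parts_inj n)) enum_uniq.
- exact/filter_uniq/undup_uniq.
rewrite mem_filter mem_partitions_upto.
apply/mapP/andP => [[t] | [/andP[Qs /eqP s_sum] /andP[s_part _]]].
  rewrite mem_enum inE => /andP[t_part Qt] ->.
  case/and3P: (t_part) => _ _ /eqP t_sum.
  by rewrite Qt t_sum eqxx t_part leqnn.
rewrite s_sum in s_part; have [t Et] := is_partition_bseq s_part.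
by exists t; rewrite // mem_enum inE Et s_part.
Qed.

(** * Shifting and peeling partitions in P_4 *)

(* Parts are read from smallest to largest, in reverse of [P4_gap]. *)
Definition P4_step (a b : nat) : bool := (a < b) && P4_gap b a.

(** Parities become remainders, a form that [lia] can decide. *)
Lemma P4_stepE a b : P4_step a b = (a < b) &&
  [|| [&& b %% 2 == 1, a %% 2 == 1 & (b - a) %% 4 == 2],
      [&& b %% 2 == 0, a %% 2 == 0 & (b - a) %% 4 == 0]
    | (b %% 2 != a %% 2) && ((b - a) %% 4 == 3)].
Proof.
rewrite /P4_step /P4_gap !modn2; congr (_ && _).
by case: (odd b); case: (odd a); rewrite /= ?orbF.
Qed.

Lemma P4_step_shift k a b : ~~ odd k -> P4_step (k + a) (k + b) = P4_step a b.
Proof.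
move=> k_even; rewrite /P4_step /P4_gap !oddD (negPf k_even) /= subnDl.
by rewrite ltn_add2l.
Qed.

Lemma path_P4_step_shift k a r : ~~ odd k ->
  path P4_step (k + a) (map (addn k) r) = path P4_step a r.
Proof.
move=> k_even; rewrite path_map; apply: eq_path => b c /=.
exact: P4_step_shift.
Qed.

Lemma path_P4_step_gt a r : path P4_step a r -> all (ltn a) r.
Proof.
move=> /(sub_path (_ : subrel P4_step ltn)) a_r.
apply: order_path_min (a_r _) => [b c d|b c]; first exact: ltn_trans.
by case/andP.
Qed.

Definition P4_partition (s : seq nat) : bool := inP4 s && all (leq 1) s.

(* The condition on the smallest part says that it may follow a virtual part
   -1; shifting by 4 turns -1 into 3. *)
Lemma P4_partitionE s :
  P4_partition s = path P4_step 3 (map (addn 4) (rev s)).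
Proof.
rewrite -[s in LHS]revK; case: (rev s) => [//|a r] /=.
rewrite (path_P4_step_shift a r (isT : ~~ odd 4)).
rewrite /P4_partition /inP4 /distinct_parts !rev_sorted rev_cons last_rcons.
rewrite -cats1 /= cats1 all_rcons all_rev.
have -> : (rcons (rev r) a == [::]) = false by case: (rev r).
have -> : path P4_step a r
          = path (fun z => gtn^~ z) a r && path (fun z => P4_gap^~ z) a r.
  by rewrite -[RHS]/(sorted _ (a :: r) && sorted _ (a :: r)) -sorted_relI.
case ar : (path (fun z => gtn^~ z) a r); last by rewrite andbF.
have gt_a : all (ltn a) r by apply: order_path_min ltn_trans ar.
have -> : (0 < a) && all (leq 1) r = (0 < a).
  case: ltnP => //= a_gt0.
  by apply: sub_all gt_a => b /=; apply: leq_trans.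
rewrite P4_stepE; case: (path _ a r); rewrite ?(andbF, andbT) //=.
lia.
Qed.

Lemma P4_partition_rcons s a :
  P4_partition (rcons s a) = P4_step 3 (4 + a) && path P4_step a (rev s).
Proof. by rewrite P4_partitionE rev_rcons /= path_P4_step_shift. Qed.

(** Raised by 2, the virtual part -1 becomes a real part 1, so the gap above 1 encodes the
    smallest-part condition on [s]. *)
Lemma P4_partition_rcons1 s :
  P4_partition (rcons (map (addn 2) s) 1) = P4_partition s.
Proof.
rewrite P4_partition_rcons P4_partitionE -map_rev /=.
rewrite -(path_P4_step_shift 1 _ (isT : ~~ odd 2)) -map_comp.
by congr path; apply: eq_map => b /=; rewrite addnA.
Qed.

(** A part 4 + b may follow 2 exactly when b is 1 or 2 modulo 4, which is the condition on a
    smallest part b. *)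
Lemma P4_partition_rcons2 s :
  P4_partition (rcons (map (addn 4) s) 2) = P4_partition s.
Proof.
rewrite P4_partition_rcons P4_partitionE -map_rev /=.
case: (rev s) => //= b r; congr (_ && _).
by rewrite !P4_stepE; lia.
Qed.

Lemma P4_partition_shift s : P4_partition (map (addn 4) s) = P4_partition s.
Proof.
rewrite !P4_partitionE -map_rev; case: (rev s) => //= b r.
rewrite !(path_P4_step_shift _ _ (isT : ~~ odd 4)); congr (_ && _).
by rewrite !P4_stepE; lia.
Qed.

Lemma P4_partition_is_partition s :
  P4_partition s -> is_partition (sumn s) s.
Proof.
rewrite /is_partition eqxx andbT => /andP[/and3P[s_dist _ _] ->].
by rewrite andbT; apply: sub_sorted s_dist => a b /ltnW.
Qed.

Lemma map_subnK k s : all (leq k) s -> s = map (addn k) (map (subn^~ k) s).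
Proof.
move=> /allP s_ge; rewrite -map_comp -[LHS]map_id.
by apply/eq_in_map => b /s_ge b_ge /=; rewrite subnKC.
Qed.

Lemma P4_partition_last1 t : P4_partition t -> last 0 t = 1 ->
  exists2 s, P4_partition s & t = rcons (map (addn 2) s) 1.
Proof.
case/lastP: t => // t a Pt; rewrite last_rcons => a1; rewrite {a}a1 in Pt *.
have /map_subnK Et : all (leq 2) t.
  move: Pt; rewrite P4_partition_rcons => /andP[_ /path_P4_step_gt].
  by rewrite all_rev.
by move: Pt; rewrite Et P4_partition_rcons1 => Pt; exists (map (subn^~ 2) t).
Qed.

Lemma P4_partition_last2 t : P4_partition t -> last 0 t = 2 ->
  exists2 s, P4_partition s & t = rcons (map (addn 4) s) 2.
Proof.
case/lastP: t => // t a Pt; rewrite last_rcons => a2; rewrite {a}a2 in Pt *.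
have /map_subnK Et : all (leq 4) t.
  move: Pt; rewrite P4_partition_rcons -all_rev => /andP[_].
  case: (rev t) => //= b r /andP[step_b /path_P4_step_gt gt_b].
  (* The part above 2 is at least 5 if odd (gap 3 mod 4) and at least 6 if even (gap 0 mod 4). *)
  have b_gt : (4 < b) by move: step_b; rewrite P4_stepE; lia.
  rewrite ltnW //=; apply: sub_all gt_b => c /= ltbc.
  exact: ltnW (ltn_trans b_gt ltbc).
by move: Pt; rewrite Et P4_partition_rcons2 => Pt; exists (map (subn^~ 4) t).
Qed.

Lemma P4_partition_last_gt t :
    P4_partition t -> last 0 t != 1 -> last 0 t != 2 ->
  exists2 s, P4_partition s & t = map (addn 4) s.
Proof.
case/lastP: t => [|t a Pt]; first by exists [::].
rewrite last_rcons => a1 a2.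
have /map_subnK Et : all (leq 4) (rcons t a).
  move: Pt; rewrite P4_partition_rcons => /andP[step_a /path_P4_step_gt].
  (* The smallest part is 1 or 2 modulo 4, but neither 1 nor 2. *)
  have a_gt : (4 < a) by move: step_a; rewrite P4_stepE; lia.
  rewrite all_rev all_rcons => gt_a; rewrite ltnW //=.
  apply: sub_all gt_a => c /= ltac; exact: ltnW (ltn_trans a_gt ltac).
move: Pt; rewrite Et P4_partition_shift => Pt.
by exists (map (subn^~ 4) (rcons t a)).
Qed.

Local Open Scope ring_scope.

(** * Sum and product identities modulo x^(n+1) *)

Section TruncatedSeries.

Variables (R : comNzRingType) (x : R) (n : nat).
Hypothesis x_nil : x ^+ n.+1 = 0.

Lemma nil_exp m : (n < m)%N -> x ^+ m = 0.
Proof. by move=> lt_nm; rewrite -(subnKC lt_nm) exprD x_nil mul0r. Qed.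

(** As x is nilpotent, a finite geometric series inverts 1 - x^(m+1). *)
Lemma lreg_onesub m : GRing.lreg (1 - x ^+ m.+1).
Proof.
have inv : (1 - x ^+ m.+1) * (\sum_(i < n.+1) (x ^+ m.+1) ^+ i) = 1.
  have := subrXX 1 (x ^+ m.+1) n.+1.
  rewrite expr1n -exprM [x ^+ (_ * _)]nil_exp ?subr0; last by lia.
  move=> {2}->; congr (_ * _); apply: eq_bigr => i _.
  by rewrite expr1n mul1r.
by move=> a b /= /(congr1 ( *%R (\sum_(i < n.+1) (x ^+ m.+1) ^+ i)));
  rewrite !mulrA ![_ * (1 - _)]mulrC inv !mul1r.
Qed.

Lemma lreg_prod I (r : seq I) (F : I -> nat) :
  GRing.lreg (\prod_(i <- r) (1 - x ^+ (F i).+1)).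
Proof.
apply: (big_ind (@GRing.lreg R)) => [|a b|i _]; last exact: lreg_onesub.
- exact: lreg1.
- exact: lregM.
Qed.

(* The unilateral identity
     sum_N (-1)^N q^(N^2) (-q;q^2)_N / (q^4;q^4)_N = (q;q^2)_oo / (-q^2;q^2)_oo,
   with the left-hand terms given by their recurrence.  Replacing the N-th term
   B N * e N by q^(2kN) * B N * e (k + N) yields sums K k with
   K k = (1 - q^(2k+1)) * K k.+1 by creative telescoping, T being the
   certificate. *)
Lemma alternating_cauchy_sum (C : nat -> R) :
  C 0 = 1 ->
  (forall N, C N.+1 * (1 - x ^+ (4 * N.+1))
             = - x ^+ (2 * N).+1 * (1 + x ^+ (2 * N).+1) * C N) ->
  (\sum_(N < n.+1) C N) * \prod_(i < 2 * n.+1) (1 + x ^+ (2 * i.+1))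
  = \prod_(k < 2 * n.+1) (1 - x ^+ (2 * k).+1).
Proof.
move=> C0 CS.
pose f i := 1 + x ^+ (2 * i.+1).
pose e j := \prod_(j <= i < 2 * n.+1) f i.
(* Beyond the range of the product [e] is 1, and so is [f j], whose power of x vanishes. *)
have eS j : e j = f j * e j.+1.
  rewrite /e; case: (ltnP j (2 * n.+1)) => [lt_j|le_j]; first by rewrite big_ltn.
  rewrite !big_geq 1?leqW // /f nil_exp ?addr0 ?mulr1 //; lia.
(* The new factor 1 + x^(2(N+1)) divides 1 - x^(4(N+1)), which leaves 1 - x^(2(N+1)) in the
   recurrence of [B]. *)
pose B N := C N * \prod_(0 <= i < N) f i.
have BS N : B N.+1 * (1 - x ^+ (2 * N.+1))
            = - x ^+ (2 * N).+1 * (1 + x ^+ (2 * N).+1) * B N.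
  rewrite /B big_nat_recr //= [RHS]mulrA -CS /f.
  have -> : x ^+ (4 * N.+1) = x ^+ (2 * N.+1) ^+ 2.
    by rewrite -exprM; congr (_ ^+ _); lia.
  by ring.
pose K k := \sum_(N < n.+1) x ^+ (2 * k) ^+ N * B N * e (k + N)%N.
have KS k : K k = (1 - x ^+ (2 * k).+1) * K k.+1.
  pose T N := x ^+ (2 * k) ^+ N * (B N * (1 - x ^+ (2 * N))) * e (k + N)%N.
  (* [T 0] contains 1 - x^0; the recurrence puts x^(2n+1) = 0 into [T n.+1]. *)
  have T0 : T 0 = 0 by rewrite /T muln0 expr0 subrr !(mulr0, mul0r).
  have Tn : T n.+1 = 0.
    by rewrite /T BS [x ^+ (2 * n).+1]nil_exp ?oppr0 ?(mul0r, mulr0) //; lia.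
  have telT : - \sum_(N < n.+1) (T N.+1 - T N) = 0.
    rewrite -(big_mkord xpredT (fun N => T N.+1 - T N)) telescope_sumr //.
    by rewrite T0 Tn subrr oppr0.
  apply/eqP; rewrite -subr_eq0; apply/eqP; rewrite -[RHS]telT.
  rewrite /K mulr_sumr -sumrB -sumrN; apply: eq_bigr => N _.
  rewrite opprB /T BS addSn addnS eS /f.
  have -> : x ^+ (2 * k.+1) ^+ N = x ^+ (2 * k) ^+ N * x ^+ (2 * N).
    by rewrite -!exprM -exprD; congr (_ ^+ _); lia.
  have -> : x ^+ (2 * (k + N).+1) = x ^+ 2 * x ^+ (2 * k) * x ^+ (2 * N).
    by rewrite -!exprD; congr (_ ^+ _); lia.
  rewrite !exprS; set u := x ^+ (2 * k); set w := x ^+ (2 * N).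
  by ring.
have K0 m : K 0 = (\prod_(k < m) (1 - x ^+ (2 * k).+1)) * K m.
  elim: m => [|m IHm]; first by rewrite big_ord0 mul1r.
  by rewrite IHm KS big_ord_recr /= mulrA.
(* For this k the terms with N > 0 contain a vanishing power of x, and the term N = 0 is 1. *)
have Kend : K (2 * n.+1)%N = 1.
  rewrite /K big_ord_recl /= big1 ?addr0 => [|i _].
    rewrite expr0 /B C0 big_geq // !mul1r /e big_geq //; lia.
  rewrite -exprM nil_exp ?mul0r //; rewrite /bump /=; nia.
move: (K0 (2 * n.+1)%N); rewrite Kend mulr1 => <-.
(* At k = 0 the first N factors in [B N] and the tail [e N] form the full product. *)
rewrite /K mulr_suml; apply: eq_bigr => N _.
rewrite muln0 expr0 expr1n mul1r add0n /B -mulrA; congr (_ * _).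
rewrite -(big_mkord xpredT f) (@big_cat_nat _ _ _ N) //=.
by have := ltn_ord N; lia.
Qed.

(** Both sides are the product of 1 - x^k over 1 <= k <= 4m, split on the left by divisibility by 4
    and on the right by parity. *)
Lemma prod_not_dvd4 m :
  (\prod_(i < 4 * m) (if (4 %| i.+1)%N then 1 else 1 - x ^+ i.+1))
    * \prod_(i < m) (1 - x ^+ (4 * i.+1))
  = (\prod_(i < 2 * m) (1 - x ^+ (2 * i).+1))
    * \prod_(i < 2 * m) (1 - x ^+ (2 * i.+1)).
Proof.
elim: m => [|m IHm]; first by rewrite !muln0 !big_ord0.
have -> : (4 * m.+1 = (4 * m).+4)%N by lia.
have -> : (2 * m.+1 = (2 * m).+2)%N by lia.
rewrite !big_ord_recr /=.
have -> : (4 %| (4 * m).+1)%N = false by lia.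
have -> : (4 %| (4 * m).+2)%N = false by lia.
have -> : (4 %| (4 * m).+3)%N = false by lia.
have -> : (4 %| (4 * m).+4)%N = true by lia.
move: IHm; set a := \prod_(i < _) _; set b := \prod_(i < _) _.
set c := \prod_(i < _) _; set d := \prod_(i < _) _ => IHm.
have -> : (2 * (2 * m) = 4 * m)%N by lia.
have -> : (2 * (2 * m).+1 = (4 * m).+2)%N by lia.
have -> : (2 * (2 * m).+2 = (4 * m).+4)%N by lia.
have -> : (4 * m.+1 = (4 * m).+4)%N by lia.
rewrite mulr1.
set y1 := 1 - _; set y2 := 1 - _; set y3 := 1 - _; set y4 := 1 - _.
transitivity (a * b * (y1 * y2 * y3 * y4)); last rewrite IHm.
  by move: a b y1 y2 y3 y4 {IHm} => a b y1 y2 y3 y4; ring.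
by move: c d y1 y2 y3 y4 {IHm} => c d y1 y2 y3 y4; ring.
Qed.

(** After multiplication by the cancellable product of the 1 - x^(4i), the factorization (1 -
    x^(2i))(1 + x^(2i)) lets the two preceding identities combine. *)
Lemma sum_eq_prod_not_dvd4 (C : nat -> R) :
  C 0 = 1 ->
  (forall N, C N.+1 * (1 - x ^+ (4 * N.+1))
             = - x ^+ (2 * N).+1 * (1 + x ^+ (2 * N).+1) * C N) ->
  \sum_(N < n.+1) C N
  = \prod_(i < 4 * n.+1) (if (4 %| i.+1)%N then 1 else 1 - x ^+ i.+1).
Proof.
move=> C0 /(alternating_cauchy_sum C0) CE.
pose A m := \prod_(i < m) (1 - x ^+ (4 * i.+1)).
(* The additional factors are 1, their powers of x being zero. *)
have A2 : A (2 * n.+1)%N = A n.+1.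
  rewrite /A -!(big_mkord xpredT (fun i => 1 - x ^+ (4 * i.+1))).
  rewrite (@big_cat_nat _ _ _ n.+1) //=; last by lia.
  rewrite [X in _ * X]big1_seq ?mulr1 // => i /andP[_].
  by rewrite mem_index_iota => i_ge; rewrite nil_exp ?subr0 //; lia.
have Areg : GRing.lreg (A n.+1).
  have -> : A n.+1 = \prod_(i < n.+1) (1 - x ^+ (4 * i + 3).+1).
    by apply: eq_bigr => i _; congr (1 - x ^+ _); lia.
  exact: lreg_prod.
apply: Areg; rewrite /= [RHS]mulrC prod_not_dvd4 -CE -A2 -mulrA mulrC.
congr (_ * _); rewrite /A -big_split /=; apply: eq_bigr => i _.
have -> : x ^+ (4 * i.+1) = x ^+ (2 * i.+1) ^+ 2.
  by rewrite -exprM; congr (_ ^+ _); lia.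
by ring.
Qed.

(** * Signed generating functions *)

Definition weight (s : seq nat) : R := (-1) ^+ size s * x ^+ sumn s.

Definition gf (Q : pred (seq nat)) : R :=
  \sum_(s <- partitions_upto n | Q s) weight s.

Lemma weight_nil s : (n < sumn s)%N -> weight s = 0.
Proof. by move=> lt_n; rewrite /weight nil_exp ?mulr0. Qed.

Lemma eq_gf Q Q' :
  (forall s, is_partition (sumn s) s -> (sumn s <= n)%N -> Q s = Q' s) ->
  gf Q = gf Q'.
Proof.
move=> eqQ; rewrite /gf big_seq_cond [RHS]big_seq_cond; apply: eq_bigl => s.
rewrite mem_partitions_upto; apply: andb_id2l => /andP[s_part s_le].
exact: eqQ.
Qed.

Lemma gf_split (A Q : pred (seq nat)) :
  gf Q = gf (predI Q A) + gf (predI Q (predC A)).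
Proof. exact: bigID. Qed.

Lemma gf_empty Q : Q =1 pred1 [::] -> gf Q = 1.
Proof.
move=> eqQ; rewrite /gf (eq_bigl _ _ eqQ) -big_filter filter_pred1_uniq ?undup_uniq //.
  by rewrite big_seq1 /weight !expr0 mulr1.
by rewrite mem_partitions_upto.
Qed.

(** Transfer along a bijection that scales weights by [c]. Since [f] never lowers the sum, preimages
    of listed partitions are listed, and images with sum above n have weight 0. *)
Lemma gf_map (Q Q' : pred (seq nat)) (f : seq nat -> seq nat) (c : R) :
    injective f ->
    (forall s, (sumn s <= sumn (f s))%N) ->
    (forall s, Q s -> is_partition (sumn s) s) ->
    (forall t, Q' t -> is_partition (sumn t) t) ->
    (forall s, Q s -> Q' (f s)) ->
    (forall t, Q' t -> exists2 s, Q s & t = f s) ->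
    (forall s, Q s -> weight (f s) = c * weight s) ->
  gf Q' = c * gf Q.
Proof.
move=> f_inj f_ge Q_part Q'_part fQ Q'f weight_f.
pose U := partitions_upto n.
transitivity
  (\sum_(t <- [seq f s | s <- U & Q s && (sumn (f s) <= n)%N]) weight t).
  rewrite /gf -big_filter; apply/perm_big/uniq_perm => [||t].
  - exact/filter_uniq/undup_uniq.
  - by rewrite map_inj_uniq //; apply/filter_uniq/undup_uniq.
  rewrite mem_filter mem_partitions_upto.
  apply/and3P/mapP => [[Q't t_part t_le] | [s]].
    have [s Qs Et] := Q'f t Q't; exists s => //.
    rewrite mem_filter Qs -Et t_le mem_partitions_upto Q_part //=.
    by rewrite (leq_trans (f_ge s)) -?Et.
  rewrite mem_filter => /andP[/andP[Qs fs_le] _] ->.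
  by split; rewrite ?fQ ?Q'_part // fQ.
rewrite big_map big_filter /gf mulr_sumr.
rewrite [RHS](bigID (fun s => sumn (f s) <= n)%N) /=.
rewrite [X in _ + X]big1 ?addr0 => [|s /andP[Qs]]; last first.
  by rewrite -weight_f // -ltnNge => /weight_nil.
by apply: eq_bigr => s /andP[/weight_f].
Qed.

(** * Partitions in P_4 by number of parts *)

Definition P4_of_size (N : nat) : pred (seq nat) :=
  fun s => P4_partition s && (size s == N).

Lemma sumn_map_addn k s : sumn (map (addn k) s) = (k * size s + sumn s)%N.
Proof. by elim: s => [|a s IHs] /=; [rewrite muln0 | rewrite IHs; lia]. Qed.

Lemma map_addn_inj k : injective (map (addn k)).
Proof. exact/inj_map/addnI. Qed.

Lemma P4_of_size_is_partition N s : P4_of_size N s -> is_partition (sumn s) s.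
Proof. by case/andP => /P4_partition_is_partition. Qed.

(* Subtract 4 from every part if the smallest part exceeds 2; otherwise delete
   the smallest part, 1 or 2, and subtract 2, respectively 4, from the others. *)
Lemma gf_P4_rec N :
  gf (P4_of_size N.+1) * (1 - x ^+ (4 * N.+1))
  = - x ^+ (2 * N).+1 * (1 + x ^+ (2 * N).+1) * gf (P4_of_size N).
Proof.
have part A t : predI (P4_of_size N.+1) A t -> is_partition (sumn t) t.
  by case/andP => /P4_of_size_is_partition.
pose last_is k : pred (seq nat) := fun t => last 0%N t == k.
have gf1 : gf (predI (P4_of_size N.+1) (last_is 1))
           = - x ^+ (2 * N).+1 * gf (P4_of_size N).
  apply: (gf_map (f := fun s => rcons (map (addn 2) s) 1)) => [s t||||s|t|s].
  - by case/rcons_inj => /map_addn_inj.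
  - by move=> s; rewrite -cats1 sumn_cat sumn_map_addn; lia.
  - exact: P4_of_size_is_partition.
  - exact: part.
  - rewrite /= /last_is last_rcons eqxx andbT /P4_of_size.
    by rewrite P4_partition_rcons1 size_rcons size_map.
  - case/andP => /andP[Pt /eqP t_size] /eqP last_t.
    have [s Ps Et] := P4_partition_last1 Pt last_t.
    exists s => //; rewrite /P4_of_size Ps.
    by move: t_size; rewrite Et size_rcons size_map => -[->] /=.
  case/andP => _ /eqP s_size.
  rewrite /weight size_rcons size_map -cats1 sumn_cat sumn_map_addn s_size.
  have -> : (2 * N + sumn s + sumn [:: 1] = (2 * N).+1 + sumn s)%N by simpl; lia.
  by rewrite exprS exprD; ring.
have gf2 : gf (predI (predI (P4_of_size N.+1) (predC (last_is 1))) (last_is 2))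
           = - x ^+ (4 * N).+2 * gf (P4_of_size N).
  apply: (gf_map (f := fun s => rcons (map (addn 4) s) 2)) => [s t||||s|t|s].
  - by case/rcons_inj => /map_addn_inj.
  - by move=> s; rewrite -cats1 sumn_cat sumn_map_addn; lia.
  - exact: P4_of_size_is_partition.
  - by move=> t /andP[/part].
  - rewrite /= /last_is last_rcons eqxx !andbT /P4_of_size.
    by rewrite P4_partition_rcons2 size_rcons size_map.
  - case/andP => /andP[/andP[Pt /eqP t_size] _] /eqP last_t.
    have [s Ps Et] := P4_partition_last2 Pt last_t.
    exists s => //; rewrite /P4_of_size Ps.
    by move: t_size; rewrite Et size_rcons size_map => -[->] /=.
  case/andP => _ /eqP s_size.
  rewrite /weight size_rcons size_map -cats1 sumn_cat sumn_map_addn s_size.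
  have -> : (4 * N + sumn s + sumn [:: 2] = (4 * N).+2 + sumn s)%N by simpl; lia.
  by rewrite exprS exprD; ring.
have gf3 : gf (predI (predI (P4_of_size N.+1) (predC (last_is 1)))
                     (predC (last_is 2)))
           = x ^+ (4 * N.+1) * gf (P4_of_size N.+1).
  apply: (gf_map (f := map (addn 4))) => [||||s|t|s].
  - exact: map_addn_inj.
  - by move=> s; rewrite sumn_map_addn; lia.
  - exact: P4_of_size_is_partition.
  - by move=> t /andP[/part].
  - rewrite /P4_of_size /= /last_is P4_partition_shift size_map => /andP[-> s_size].
    rewrite s_size /=; case/lastP: s s_size => // s a _.
    by rewrite map_rcons last_rcons.
  - case/andP => /andP[/andP[Pt /eqP t_size] last1] last2.
    have [s Ps Et] := P4_partition_last_gt Pt last1 last2.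
    by exists s; rewrite // /P4_of_size Ps -t_size Et size_map /=.
  case/andP => _ /eqP s_size.
  by rewrite /weight size_map sumn_map_addn s_size exprD; ring.
have := gf_split (last_is 1) (P4_of_size N.+1).
rewrite gf1 (gf_split (last_is 2) (predI _ _)) gf2 gf3 => gfE.
rewrite mulrBr mulr1 [X in X - _]gfE.
(* The class [gf3] cancels the subtracted term; the other two share the factor x^(2N+1). *)
have -> : (4 * N).+2 = ((2 * N).+1 + (2 * N).+1)%N by lia.
rewrite exprD; ring.
Qed.

(** The parts are positive, so there are at most n of them and [inord] keeps the size. *)
Lemma gf_P4 : gf P4_partition = \sum_(N < n.+1) gf (P4_of_size N).
Proof.
rewrite /gf (partition_big (fun s => inord (size s) : 'I_n.+1) xpredT) //=.
apply: eq_bigr => N _; apply: eq_gf => s /and3P[_ s_pos _] s_le.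
rewrite /P4_of_size -val_eqE /= inordK // ltnS (leq_trans _ s_le) //.
elim: s s_pos {s_le} => //= k s IHs /andP[k_gt0 /IHs].
by rewrite -add1n; apply: leq_add.
Qed.

(** * Distinct parts not divisible by 4 *)

(** Starting the path at [K.+1] bounds the parts by [K]. *)
Definition S4_upto (K : nat) : pred (seq nat) :=
  fun s => path gtn K.+1 s && all (fun k => ~~ (4 %| k)%N) s.

Lemma S4_upto_is_partition K s : S4_upto K s -> is_partition (sumn s) s.
Proof.
rewrite /S4_upto /is_partition eqxx andbT => /andP[/path_sorted s_dist s_ndvd].
apply/andP; split; first by apply: sub_sorted s_dist => a b /ltnW.
by apply: sub_all s_ndvd => -[].
Qed.

(** Either K+1 does not occur, or it is the largest part, and removing it takes off the factor
    -x^(K+1). *)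
Lemma gf_S4_uptoS K :
  gf (S4_upto K.+1) = gf (S4_upto K) * (if (4 %| K.+1)%N then 1 else 1 - x ^+ K.+1).
Proof.
pose head_is : pred (seq nat) := fun t => head 0%N t == K.+1.
have tailE : gf (predI (S4_upto K.+1) (predC head_is)) = gf (S4_upto K).
  apply: eq_gf => -[|a s] _ _; first by rewrite /S4_upto /= /head_is.
  rewrite /S4_upto /= /head_is /= !ltnS leq_eqVlt.
  by case: eqP => [->|_]; rewrite ?andbF ?ltnn ?andbT.
(* An elimination rule for any goal [A]: it refutes the case 4 | K+1 and yields preimages
   otherwise. *)
have eq_head A t : predI (S4_upto K.+1) head_is t ->
    (forall s, S4_upto K s -> ~~ (4 %| K.+1)%N -> t = K.+1 :: s -> A) -> A.
  case: t => [|a s] /andP[] //; rewrite /S4_upto /head_is /= => /andP[/andP[_ Ks]].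
  by move=> /andP[ndvd s_ndvd] /eqP Ea; subst a => /(_ s); rewrite Ks; apply.
case: ifPn => [dvd4|ndvd4].
  rewrite mulr1 -tailE (gf_split head_is) [X in X + _]big1 ?add0r //.
  by move=> t Qt; apply: (eq_head _ _ Qt) => s _; rewrite dvd4.
have headE : gf (predI (S4_upto K.+1) head_is) = - x ^+ K.+1 * gf (S4_upto K).
  apply: (gf_map (f := cons K.+1)) => [s t [] //|s|||s|t|s _].
  - exact: leq_addl.
  - exact: S4_upto_is_partition.
  - by move=> t /andP[/S4_upto_is_partition].
  - by rewrite /S4_upto /= /head_is /= eqxx ltnSn ndvd4 andbT.
  - by move=> Qt; apply: (eq_head _ _ Qt) => s Qs _ ->; exists s.
  by rewrite /weight /= exprS exprD; ring.
rewrite (gf_split head_is) tailE headE; ring.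
Qed.

Lemma gf_S4_upto K :
  gf (S4_upto K) = \prod_(i < K) (if (4 %| i.+1)%N then 1 else 1 - x ^+ i.+1).
Proof.
elim: K => [|K IHK]; last by rewrite big_ord_recr /= gf_S4_uptoS IHK.
(* For K = 0 the only candidate part is 0, which 4 divides. *)
by rewrite big_ord0; apply: gf_empty => -[|[|a] s] //=; rewrite /S4_upto /= andbF.
Qed.

Lemma gf_S4 K : (n <= K)%N -> gf inS4 = gf (S4_upto K).
Proof.
move=> le_nK; apply: eq_gf => s _ s_le; rewrite /inS4 /S4_upto; congr (_ && _).
case: s s_le => //= a s s_le; rewrite ltnS (leq_trans _ le_nK) //.
exact: leq_trans (leq_addr _ _) s_le.
Qed.

Lemma gf_P4_eq_gf_S4 : gf inP4 = gf inS4.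
Proof.
have -> : gf inP4 = gf P4_partition.
  by apply: eq_gf => s /and3P[_ s_pos _] _; rewrite /P4_partition s_pos andbT.
rewrite (@gf_S4 (4 * n.+1)%N) ?gf_S4_upto; last by lia.
rewrite gf_P4; apply: (sum_eq_prod_not_dvd4 (C := fun N => gf (P4_of_size N)) _ gf_P4_rec).
by apply: gf_empty => -[|a s]; rewrite /P4_of_size ?andbF.
Qed.

End TruncatedSeries.

(** * Reading off integer coefficients *)

Lemma count_even_sub_odd (Q : pred (seq nat)) (L : seq (seq nat)) :
  (count (fun s => Q s && ~~ odd (size s)) L)%:Z
    - (count (fun s => Q s && odd (size s)) L)%:Z
  = \sum_(s <- L | Q s) (-1) ^+ size s.
Proof.
elim: L => [|s L IHL]; first by rewrite big_nil subrr.
rewrite big_cons /= !PoszD -signr_odd -{}IHL.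
by case: (Q s); case: (odd _) => /=; ring.
Qed.

Lemma signed_count_coef (Q : pred (seq nat)) n :
  (count_partitions (fun s => Q s && ~~ odd (size s)) n)%:Z
    - (count_partitions (fun s => Q s && odd (size s)) n)%:Z
  = (gf 'X n Q : {poly int})`_n.
Proof.
rewrite !count_partitionsE.
under eq_count => s do rewrite andbAC.
under [in X in _ - X]eq_count => s do rewrite andbAC.
rewrite (count_even_sub_odd (fun s => Q s && (sumn s == n))) coef_sum.
rewrite big_mkcondr /=; apply: eq_bigr => s _.
rewrite /weight -[in RHS]signr_odd mulr_sign -signr_odd; case: (odd _).
  by rewrite coefN coefXn expr1 eq_sym; case: eqP; rewrite ?oppr0.
by rewrite coefXn expr0 eq_sym; case: eqP.
Qed.

Theorem theorem6p1 (n : nat) :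
  ((P4e n)%:Z - (P4o n)%:Z = (S4e n)%:Z - (S4o n)%:Z)%R.
Proof.
rewrite /P4e /P4o /S4e /S4o !signed_count_coef.
pose h : {poly int} := 'X^(n.+1).
(* The quotient is modulo [mk_monic h], which defaults to ['X] unless [h] is monic and
   nonconstant. *)
have hE : mk_monic h = h by exact: mk_monic_Xn.
pose y : {poly %/ h} := in_qpoly h 'X.
have y_nil : y ^+ n.+1 = 0.
  rewrite -rmorphXn /=; apply/val_inj => /=.
  by rewrite hE Pdiv.RingMonic.rmodpp ?monicXn.
have gfE Q : in_qpoly h (gf 'X n Q) = gf y n Q.
  rewrite /gf rmorph_sum; apply: eq_bigr => s _.
  by rewrite /weight rmorphM !rmorphXn rmorphN1.
(* The polynomial has degree at most n, so reduction modulo X^(n+1) preserves it. *)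
have gf_coef Q : (gf 'X n Q : {poly int})`_n = (polyn (gf y n Q))`_n.
  rewrite -gfE in_qpoly_small // hE size_polyXn ltnS.
  rewrite /gf big_seq_cond; apply: (big_ind (fun p : {poly int} => size p <= n.+1)%N).
  - by rewrite size_poly0.
  - by move=> p q p_le q_le; rewrite (leq_trans (size_polyD _ _)) // geq_max p_le.
  move=> s; rewrite mem_partitions_upto => /andP[/andP[_ s_le] _].
  by rewrite /weight -signr_odd mulr_sign; case: (odd _);
    rewrite ?size_polyN size_polyXn.
by rewrite !gf_coef gf_P4_eq_gf_S4.
Qed.
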